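(* Let $\Sigma$ be a compact Hausdorff space, $X=\Sigma^{\mathbb Z}$ with the product topology and $S:X\to X$ the left shift. Let $x\in X$ be a nonperiodic recurrent point satisfying $\limsup_{p\to\infty}M_p(x)=\infty$, and let $\{p_i\}_{i\in\mathbb N}$ be a strictly increasing sequence of natural numbers with $p_i\in\mathcal P(x)$ and $p_i\mid p_{i+1}$ for all $i$, and $\lim_{i\to\infty}M_{p_i}(x)=\infty$. For $i\in\mathbb N$ and $j\in\{0,1,\dots,p_i-1\}$ put $$A^i_j=\{y\in\overline{\mathrm{Orb}(x)} : y(k-j)=x(k)\ \text{ for all } k\in\mathrm{Per}_{p_i}(x)\}.$$ Then: (i) for every $i\in\mathbb N$ the family $\{A^i_j\}_{j=0}^{p_i-1}$ is a periodic partition of the dynamical system $(\overline{\mathrm{Orb}(x)},S)$ of length $p_i$; (ii) $A^i_n\supset A^j_m$ whenever $i<j$, $n\in\{0,\dots,p_i-1\}$, $m\in\{0,\dots,p_j-1\}$ and $m\equiv n\pmod{p_i}$.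
   Context: $\mathbb N=\{1,2,\dots\}$. Elements of $X$ are written $x=(x(n))_{n\in\mathbb Z}$; the left shift is the homeomorphism $(Sx)(n)=x(n+1)$. $\mathrm{Orb}(x)=\{S^k x: k\in\mathbb Z\}$ and the bar denotes closure in $X$. A point is nonperiodic if $S^k x\neq x$ for all $k\in\mathbb N$. For $x\in X$, $p\in\mathbb N$, $\sigma\in\Sigma$: $\mathrm{Per}_p(x,\sigma)=\{n\in\mathbb Z : x(n')=\sigma \text{ for all } n'\equiv n \pmod p\}$, $\mathrm{Per}_p(x)=\bigcup_{\sigma\in\Sigma}\mathrm{Per}_p(x,\sigma)$. $M_p(x)=\max\{k\in\mathbb N : \exists n\in\mathbb Z,\ n+i\in\mathrm{Per}_p(x) \text{ for } i=0,1,\dots,k-1\}$ (with value $\infty$ if such lengths are unbounded, and $0$ if $\mathrm{Per}_p(x)=\emptyset$). A number $p\in\mathbb N$ is an essential period of $x$, written $p\in\mathcal P(x)$, if for every $q\in\mathbb N$: whenever $\mathrm{Per}_p(x,\sigma)\subseteq\mathrm{Per}_p(x,\sigma)-q$ for all $\sigma\in\Sigma$, then $p\mid q$. A point $x$ is recurrent (in this paper's sense) if for every open neighbourhood $U$ of $x$ there is $n(U)\in\mathbb N$ such that for every $k\in\mathbb Z$, $U\cap\{S^i x: k\le i\le k+n(U)-1\}\ne\emptyset$. The set $A^i_j$ consists of the points of $\overline{\mathrm{Orb}(x)}$ which have the same $p_i$-skeleton as $S^j(x)$. For a compact Hausdorff space $Y$ and a homeomorphism $f:Y\to Y$, a finite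 family $\{W_i\}_{i=0}^{n-1}$ of subsets of $Y$ is a periodic partition of $(Y,f)$ of length $n$ if: all $W_i$ are open and closed in $Y$; $W_i=f(W_{i-1})$ for $i=1,\dots,n-1$ and $W_0=f(W_{n-1})$; $W_i\cap W_j=\emptyset$ for $i\ne j$; and $Y=\bigcup_{i=0}^{n-1}W_i$. *)

(* Defs.v *)
From HB Require Import structures.
From mathcomp Require Import all_boot all_order all_algebra.
From mathcomp Require Import all_classical all_reals all_analysis.

Set Implicit Arguments.
Unset Strict Implicit.
Unset Printing Implicit Defensive.

Import Order.TTheory GRing.Theory Num.Theory.
Import numFieldNormedType.Exports.

Local Open Scope classical_set_scope.
Local Open Scope ring_scope.

(* A number ranging over {1, 2, ...} is a nat with a positivity hypothesis. *)

Section dynamical_systems.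
Context {Y : topologicalType}.

Definition homeomorphism (f : Y -> Y) : Prop :=
  continuous f /\ exists g : Y -> Y, [/\ continuous g, cancel f g & cancel g f].

Definition dynamical_system (f : Y -> Y) : Prop :=
  [/\ compact [set: Y], hausdorff_space Y & homeomorphism f].

(* Only the values W 0, ..., W n.-1 of the family matter. *)
Definition periodic_partition (f : Y -> Y) (n : nat) (W : nat -> set Y) : Prop :=
  (0 < n)%N /\
  [/\ forall i, (i < n)%N -> open (W i) /\ closed (W i),
      forall i, (0 < i < n)%N -> W i = f @` W i.-1,
      W 0%N = f @` W n.-1,
      forall i j, (i < n)%N -> (j < n)%N -> i <> j -> W i `&` W j = set0 &
      [set: Y] = \bigcup_(i in [set i : nat | (i < n)%N]) W i].

End dynamical_systems.

Section two_sided_shift.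
Context {Sigma : topologicalType}.

(* {ptws int -> Sigma} carries the topology of pointwise convergence, that is,
   the product topology of Sigma^Z. *)
Local Notation X := {ptws int -> Sigma}.

Definition left_shift (x : X) : X := fun n => x (n + 1).

Definition right_shift (x : X) : X := fun n => x (n - 1).

Definition shift_pow (k : int) (x : X) : X :=
  match k with
  | Posz n => iter n left_shift x
  | Negz n => iter n.+1 right_shift x
  end.

Definition shift_orbit (x : X) : set X := [set shift_pow k x | k in [set: int]].

Definition orbit_closure (x : X) : set X := closure (shift_orbit x).

Definition nonperiodic (x : X) : Prop :=
  forall k : nat, (0 < k)%N -> shift_pow k%:Z x <> x.

Definition Per_sym (p : nat) (x : X) (sigma : Sigma) : set int :=
  [set n | forall n' : int, (n' = n %[mod p%:Z])%Z -> x n' = sigma].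

Definition Per (p : nat) (x : X) : set int :=
  \bigcup_(sigma in [set: Sigma]) Per_sym p x sigma.

(* The length k = 0 is always admissible, so the supremum is 0 when Per p x is
   empty, the largest admissible length when there is one, and +oo otherwise. *)
Definition max_run (R : realType) (p : nat) (x : X) : \bar R :=
  ereal_sup [set (k%:R)%:E | k in
    [set k : nat | exists n : int,
       forall i : nat, (i < k)%N -> Per p x (n + i%:Z)]].

Definition essential_period (x : X) (p : nat) : Prop :=
  (0 < p)%N /\
  forall q : nat, (0 < q)%N ->
    (forall sigma : Sigma,
        Per_sym p x sigma `<=` [set n - q%:Z | n in Per_sym p x sigma]) ->
    (p %| q)%N.

(* The bound n on return times is uniform in k, so this is stronger than the
   usual topological recurrence. *)
Definition recurrent (x : X) : Prop :=
  forall U : set X, open U -> U x ->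
    exists n : nat, (0 < n)%N /\
      forall k : int,
        U `&` [set shift_pow i x | i in [set i : int | k <= i <= k + n%:Z - 1]]
          !=set0.

(* As a type, orbit_closure x is the subtype set_type (orbit_closure x), with
   the topology induced from Sigma^Z. *)
Definition skeleton_class (x : X) (p j : nat) : set (orbit_closure x) :=
  [set y | forall k : int, Per p x k -> (val y : X) (k - j%:Z) = x k].

Lemma shift_powE (k : int) (x : X) : shift_pow k x = fun n => x (n + k).
Proof.
case: k => m /=.
- elim: m x => [|m IH] x /=; first by apply/funext => n; rewrite addr0.
  rewrite IH; apply/funext => n; rewrite /left_shift; congr x.
  by rewrite -addrA -intS.
- rewrite -iterS NegzE; move: m.+1 => {}m; elim: m x => [|m IH] x /=.
    by apply/funext => n; rewrite subr0.
  rewrite IH; apply/funext => n; rewrite /right_shift; congr x.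
  by rewrite -addrA -opprD -intS.
Qed.

Lemma left_shiftK : cancel left_shift right_shift.
Proof. by move=> x; apply/funext => n; rewrite /right_shift /left_shift subrK. Qed.

Lemma right_shiftK : cancel right_shift left_shift.
Proof. by move=> x; apply/funext => n; rewrite /right_shift /left_shift addrK. Qed.

Lemma reindex_continuous (h : int -> int) (f : X -> X) :
  (forall x n, f x n = x (h n)) -> continuous f.
Proof.
move=> fE x; apply/cvg_sup; first exact/fmap_filter/nbhs_filter.
move=> n U [V [[W oW <-] /= Wx] VU].
have hW : nbhs (x (h n)) W by rewrite -fE; exact: open_nbhs_nbhs.
have := @proj_continuous _ (fun=> Sigma) (h n) x W hW.
change (nbhs x (proj (h n) @^-1` W) -> nbhs x (f @^-1` U)).
apply: (@filterS _ _ (nbhs_filter (x : X))) => y Wy; apply: VU.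
by rewrite /= fE.
Qed.

Lemma left_shift_continuous : continuous left_shift.
Proof. exact: (@reindex_continuous (fun n => n + 1)). Qed.

Lemma right_shift_continuous : continuous right_shift.
Proof. exact: (@reindex_continuous (fun n => n - 1)). Qed.

Lemma closure_stable (f : X -> X) (B : set X) : continuous f ->
  (forall y, B y -> B (f y)) -> forall y, closure B y -> closure B (f y).
Proof.
move=> cf fB y By U /cf /By[z [Bz Uz]].
by exists (f z); split=> //; exact: fB.
Qed.

Lemma orbit_closure_left (x y : X) :
  orbit_closure x y -> orbit_closure x (left_shift y).
Proof.
apply: closure_stable; first exact: left_shift_continuous.
move=> _ [k _ <-]; exists (k + 1) => //; rewrite !shift_powE.
by apply/funext => n; rewrite /left_shift addrCA addrC -addrA addrC.
Qed.

Lemma orbit_closure_right (x y : X) :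
  orbit_closure x y -> orbit_closure x (right_shift y).
Proof.
apply: closure_stable; first exact: right_shift_continuous.
move=> _ [k _ <-]; exists (k - 1) => //; rewrite !shift_powE.
by apply/funext => n; rewrite /right_shift addrCA addrC -addrA addrC.
Qed.

Definition orbit_shift (x : X) (y : orbit_closure x) : orbit_closure x :=
  SigSub (mem_set (orbit_closure_left (set_valP y))).

Definition orbit_shift_inv (x : X) (y : orbit_closure x) : orbit_closure x :=
  SigSub (mem_set (orbit_closure_right (set_valP y))).

Lemma orbit_closure_dynamical_system (x : X) :
  compact [set: Sigma] -> hausdorff_space Sigma ->
  dynamical_system (@orbit_shift x).
Proof.
move=> cS hS.
have cX : compact [set: X].
  have := @tychonoff int (fun=> Sigma) (fun=> setT) (fun=> cS).
  by congr (compact _); apply/seteqP; split.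
have hX : hausdorff_space X.
  exact: (@hausdorff_product int (fun=> Sigma) (fun=> hS)).
have cval : continuous (val : orbit_closure x -> X).
  exact: initial_continuous.
have cont (f : X -> X) (g : orbit_closure x -> orbit_closure x) :
    continuous f -> (forall y, val (g y) = f (val y)) -> continuous g.
  move=> cf gE; apply: continuous_comp_initial => y.
  have -> : set_val \o g = f \o val by apply/funext => z; exact: gE.
  by apply: continuous_comp; [exact: cval|exact: cf].
split.
- have : compact (orbit_closure x).
    by apply: (subclosed_compact _ cX) => //; exact: closed_closure.
  move=> cO F PF _.
  have FO : (val @ F) (orbit_closure x).
    by apply: (@filterS _ F _ setT _ _ filterT) => z _; exact: set_valP.
  have [y [Oy cly]] := cO (val @ F) (fmap_proper_filter _ PF) FO.
  exists (SigSub (mem_set Oy)); split=> // P Q FP [V [[W oW <-] /= Wy] VQ].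
  have [z [[u Pu <-] Wu]] := cly (val @` P) W
    (filterS (@preimage_image _ _ val P) FP) (open_nbhs_nbhs (conj oW Wy)).
  by exists u; split=> //; apply: VQ.
- move=> y z yz; apply: val_inj; apply: hX => P Q nP nQ.
  by have [u [? ?]] := yz _ _ (cval y P nP) (cval z Q nQ); exists (val u).
- split; first by apply: (cont _ _ left_shift_continuous).
  exists (@orbit_shift_inv x); split.
  + by apply: (cont _ _ right_shift_continuous).
  + by move=> y; apply: val_inj; exact: left_shiftK.
  + by move=> y; apply: val_inj; exact: right_shiftK.
Qed.

End two_sided_shift.

Arguments skeleton_class {Sigma} x p j _.
Arguments orbit_shift {Sigma} x y.

(* Main.v *)
Require Import Defs.
From HB Require Import structures.
From mathcomp Require Import all_boot all_order all_algebra.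
From mathcomp Require Import all_classical all_reals all_analysis.
Import Order.TTheory GRing.Theory Num.Theory.
Import numFieldNormedType.Exports.
Local Open Scope classical_set_scope.
Local Open Scope ring_scope.

(** Write [A_d] for the set of all points [y] of the full shift such that
    [y (k - d) = x k] for every [k] in [Per p x] ([skeleton_shift] below); it
    contains [S^d x], and [A^i_j] is its trace on the orbit closure of [x].

    The sets [A_d] are closed, depend only on [d] modulo [p], and the shift
    maps [A_d] into [A_(d+1)].  Hence the finitely many [A_r], [r < p], cover the
    orbit of [x], and also its closure ([orbit_closure_covered]).  Once they are
    known to be disjoint, each of them is the complement of a finite union of
    closed sets, hence open, so everything reduces to disjointness.

    For disjointness, the uniform return times of a recurrent point make its
    orbit closure minimal: [x] lies in the orbit closure of every [y] of its own
    orbit closure ([recurrent_minimal]).  If such a [y] lies in [A_d], the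
    covering property applied to the base point [y] provides one [r] such that
    [x] lies in the set [A_r] of [y].  Shifts of skeletons compose
    ([skeleton_shift_trans]), so [x] lies in its own set [A_(d+r)], and
    [p] divides [d + r] because [p] is an essential period.  As [r] depends
    on [y] alone, [y] determines [d] modulo [p].

    The inclusion between the classes of two periods only uses that a position
    of period [p] also has period [q] when [p] divides [q]
    ([skeleton_shift_mono]). *)

(** * Shifts of the skeleton of a point *)

Section skeletons.
Set Implicit Arguments.
Unset Strict Implicit.
Context {Sigma : topologicalType}.
Local Notation X := {ptws int -> Sigma}.
Implicit Types (x y z : X) (p q : nat) (d e : int).

(** The shift [d] ranges over all integers, so that shifts can be added. *)
Definition skeleton_shift p x d : set X :=
  [set y | forall k : int, Per p x k -> y (k - d) = x k].

Lemma Per_period p x k d :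
  (p%:Z %| d)%Z -> Per p x k -> x (k + d) = x k /\ Per p x (k + d).
Proof.
move=> pd [s _ xs]; have xk : x k = s by exact: xs.
have kd : (k + d = k %[mod p%:Z])%Z.
  by apply/eqP; rewrite eqz_mod_dvd addrAC subrr add0r.
split; first by rewrite xk; exact: xs.
by exists s => // n nk; apply: xs; rewrite nk.
Qed.

Lemma Per_of_period p x k :
  (forall d, (p%:Z %| d)%Z -> x (k + d) = x k) -> Per p x k.
Proof.
move=> h; exists (x k) => // n nk; have := h (n - k); rewrite [k + _]addrC subrK; apply.
by rewrite -eqz_mod_dvd; exact/eqP.
Qed.

(** A position [k] of period [p] can be moved within its class modulo [p] before
    it is used as a position of period [q], which turns [d] into [e].  For
    [p = q], only the class of [d] modulo [p] matters. *)
Lemma skeleton_shift_mono p q x d e : (p %| q)%N -> (p%:Z %| d - e)%Z ->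
  skeleton_shift q x d `<=` skeleton_shift p x e.
Proof.
move=> pq pde y yd k Pk; have [xk Pk'] := Per_period pde Pk.
have Qk' : Per q x (k + (d - e)).
  apply: Per_of_period => c qc; apply: (Per_period _ Pk').1.
  exact: (@dvdz_trans q%:Z).
by rewrite -xk -yd //; congr (y _); rewrite addrCA addrC addrK.
Qed.

Lemma skeleton_shift_mod p x d e : (p%:Z %| d - e)%Z ->
  skeleton_shift p x d `<=` skeleton_shift p x e.
Proof. exact: skeleton_shift_mono. Qed.

(** The symbol of [x] at [k] is repeated by [y] along the whole residue class
    of [k - d], so that [k - d] is again a position of period [p], for [y]. *)
Lemma skeleton_shift_trans p x y z d e :
  skeleton_shift p x d y -> skeleton_shift p y e z ->
  skeleton_shift p x (d + e) z.
Proof.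
move=> xy yz k Pk; rewrite opprD addrA yz; first exact: xy.
apply: Per_of_period => c pc; have [xc Pc] := Per_period pc Pk.
by rewrite addrAC !xy.
Qed.

Lemma skeleton_shift_pow p x d : skeleton_shift p x d (shift_pow d x).
Proof. by move=> k _; rewrite shift_powE subrK. Qed.

Lemma skeleton_shift_succ p x y d :
  skeleton_shift p x d y -> skeleton_shift p x (d + 1) (left_shift y).
Proof. by move=> xy k Pk; rewrite /left_shift opprD addrA subrK xy. Qed.

Lemma skeleton_shift_pred p x y d :
  skeleton_shift p x (d + 1) y -> skeleton_shift p x d (right_shift y).
Proof. by move=> xy k Pk; rewrite /right_shift -addrA -opprD xy. Qed.

Lemma skeleton_shift_closed p x d :
  hausdorff_space Sigma -> closed (skeleton_shift p x d).
Proof.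
move=> hS.
rewrite (_ : skeleton_shift p x d =
  \bigcap_(k in Per p x) ((fun y : X => y (k - d)) @^-1` [set x k])); last first.
  by apply/seteqP; split.
apply: closed_bigI => k _; apply: preimage_closed.
  by move=> y _; exact: (@proj_continuous int (fun=> Sigma) (k - d)).
exact/accessible_closed_set1/hausdorff_accessible.
Qed.

(** A finite union of closed sets containing the orbit contains its closure. *)
Lemma orbit_closure_covered p x : (0 < p)%N -> hausdorff_space Sigma ->
  orbit_closure x `<=`
  \bigcup_(r in [set r : nat | (r < p)%N]) skeleton_shift p x r%:Z.
Proof.
move=> p0 hS.
have cU : closed (\bigcup_(r in [set r : nat | (r < p)%N])
                    skeleton_shift p x r%:Z).
  apply: closed_bigcup; first exact: finite_II.
  by move=> r _; exact: skeleton_shift_closed.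
apply: subset_trans cU; apply: closureS => _ [k _ <-].
have pz : p%:Z != 0 by rewrite eqz_nat -lt0n.
have r0 : (0 <= k %% p%:Z)%Z by exact: modz_ge0.
exists `|(k %% p%:Z)%Z|%N => /=; first by rewrite -ltz_nat gez0_abs// ltz_pmod// ltz_nat.
apply: (@skeleton_shift_mod _ _ k); last exact: skeleton_shift_pow.
by rewrite gez0_abs// -eqz_mod_dvd modz_mod.
Qed.

(** * Essential periods, minimality and disjointness *)

(** The definition of an essential period quantifies over positive shifts [q]
    and over each symbol separately; only the class of the shift modulo [p]
    matters, and all symbols can be treated at once. *)
Lemma essential_period_dvd p x d :
  essential_period x p -> skeleton_shift p x d x -> (p%:Z %| d)%Z.
Proof.
move=> [p0 xp] xd; have pz : p%:Z != 0 by rewrite eqz_nat -lt0n.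
have r0 : (0 <= - d %% p%:Z)%Z by exact: modz_ge0.
(* the positive representative of - d modulo p, kept nonzero by adding p *)
pose q := (`|(- d %% p%:Z)%Z| + p)%N.
have qE : q%:Z = (- d %% p%:Z)%Z + p%:Z by rewrite PoszD gez0_abs.
have pqd : (p%:Z %| q%:Z + d)%Z.
  rewrite qE addrAC; apply: rpredD; last exact: dvdzz.
  by have := modz_mod (- d) p%:Z => /eqP; rewrite eqz_mod_dvd opprK.
have xq : skeleton_shift p x (- q%:Z) x.
  by apply: skeleton_shift_mod xd; rewrite opprK addrC.
have pq : (p%:Z %| q%:Z)%Z.
  apply: xp => [|s k xs]; first by rewrite addn_gt0 p0 orbT.
  exists (k + q%:Z); last by rewrite addrK.
  have xk : x k = s by exact: xs.
  move=> n nk; have nqk : (n - q%:Z = k %[mod p%:Z])%Z.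
    apply/eqP; rewrite eqz_mod_dvd -addrA -opprD [q%:Z + k]addrC -eqz_mod_dvd.
    exact/eqP.
  have Pn : Per p x (n - q%:Z).
    by exists s => // m mn; apply: xs; rewrite mn.
  by have := xq _ Pn; rewrite opprK subrK => ->; exact: xs.
by have := rpredB pqd pq; rewrite addrAC subrr add0r.
Qed.

(** If every stretch of [n] consecutive iterates of [x] visits a neighbourhood
    [W] of [x], the orbit of [x] is contained in the union of the preimages of
    [closure W] under [S^i], [i < n].  This union is closed, so every [y] in the
    orbit closure returns to [closure W]; by regularity, the sets [closure W]
    form a neighbourhood basis of [x]. *)
Lemma recurrent_minimal x y :
  compact [set: Sigma] -> hausdorff_space Sigma -> recurrent x ->
  orbit_closure x y -> orbit_closure y x.
Proof.
move=> cS hS recx xy U nU.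
have cX : compact [set: X].
  have := @tychonoff int (fun=> Sigma) (fun=> setT) (fun=> cS).
  by congr (compact _); apply/seteqP; split.
have hX : hausdorff_space X.
  exact: (@hausdorff_product int (fun=> Sigma) (fun=> hS)).
have [W nW WU] := compact_regular hX cX (@filterT _ (nbhs x) _) nU.
have [n [n0 ret]] := recx W° (@open_interior _ W) nW.
pose C := \bigcup_(i in [set i : nat | (i < n)%N])
            (shift_pow i%:Z @^-1` closure W).
have cC : closed C.
  apply: closed_bigcup; first exact: finite_II.
  move=> i _; apply: preimage_closed; last exact: closed_closure.
  move=> z _; apply: (@reindex_continuous _ (fun m => m + i%:Z)).
  by move=> u m; rewrite shift_powE.
have [i _ Wi] : C y.
  apply: cC; apply: closureS xy => _ [k _ <-].
  have [z [Wz [t /andP[kt tn] tE]]] := ret k.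
  have tk : 0 <= t - k by rewrite subr_ge0.
  exists `|t - k|%N.
    rewrite /= -ltz_nat gez0_abs// ltrBlDl; apply: (le_lt_trans tn).
    by rewrite ltrBlDr ltrDl.
  apply: subset_closure; apply: interior_subset.
  rewrite (_ : shift_pow `|t - k|%N (shift_pow k x) = z)//.
  rewrite -tE !shift_powE gez0_abs//; apply/funext => m.
  by congr (x _); rewrite -addrA subrK.
by exists (shift_pow i%:Z y); split; [exists i%:Z|exact: WU].
Qed.

(** Coming back from [y] to [x] costs a shift [r] that is the same for [d] and
    [e], and both [d + r] and [e + r] preserve the skeleton of [x]. *)
Lemma skeleton_shift_inj p x y d e :
  compact [set: Sigma] -> hausdorff_space Sigma ->
  recurrent x -> essential_period x p -> orbit_closure x y ->
  skeleton_shift p x d y -> skeleton_shift p x e y -> (p%:Z %| d - e)%Z.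
Proof.
move=> cS hS recx xp xy yd ye.
have [r _ xr] := @orbit_closure_covered p y xp.1 hS _
  (recurrent_minimal cS hS recx xy).
have pd := essential_period_dvd xp (skeleton_shift_trans yd xr).
have pe := essential_period_dvd xp (skeleton_shift_trans ye xr).
by have := rpredB pd pe; rewrite opprD addrACA subrr addr0.
Qed.

(** * The periodic partition of the orbit closure *)

Lemma orbit_shift_skeleton_class x p j :
  orbit_shift x @` skeleton_class x p j = skeleton_class x p j.+1.
Proof.
have jS : j.+1%:Z = j%:Z + 1 by rewrite -addn1 PoszD.
apply/seteqP; split=> [_ [y xy <-]|y xy].
  have := @skeleton_shift_succ p x (val y) j%:Z xy.
  by rewrite -jS.
exists (@orbit_shift_inv _ x y); last by apply: val_inj; exact: right_shiftK.
by apply: skeleton_shift_pred; rewrite -jS.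
Qed.

Lemma skeleton_class_closed x p j :
  hausdorff_space Sigma -> closed (skeleton_class x p j).
Proof.
move=> hS; rewrite (_ : skeleton_class x p j =
  (val : orbit_closure x -> X) @^-1` skeleton_shift p x j%:Z)//.
apply: preimage_closed; last exact: skeleton_shift_closed.
by move=> y _; exact: initial_continuous.
Qed.

Lemma skeleton_class_cover x p : (0 < p)%N -> hausdorff_space Sigma ->
  [set: orbit_closure x] =
  \bigcup_(j in [set j : nat | (j < p)%N]) skeleton_class x p j.
Proof.
move=> p0 hS; apply/seteqP; split=> // y _.
exact: (orbit_closure_covered p0 hS (set_valP y)).
Qed.

Lemma skeleton_class_disjoint x p i j :
  compact [set: Sigma] -> hausdorff_space Sigma ->
  recurrent x -> essential_period x p ->
  (i < p)%N -> (j < p)%N -> i <> j ->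
  skeleton_class x p i `&` skeleton_class x p j = set0.
Proof.
move=> cS hS recx xp ip jp ij; rewrite -subset0 => y [yi yj]; apply: ij.
have := skeleton_shift_inj cS hS recx xp (set_valP y) yi yj.
by rewrite -eqz_mod_dvd !modz_nat eqz_nat !modn_small// => /eqP.
Qed.

Lemma skeleton_class_periodic_partition x p :
  compact [set: Sigma] -> hausdorff_space Sigma ->
  recurrent x -> essential_period x p ->
  periodic_partition (orbit_shift x) p (skeleton_class x p).
Proof.
move=> cS hS recx xp; have p0 := xp.1.
have disj := @skeleton_class_disjoint x p _ _ cS hS recx xp.
split=> //; split=> //.
- move=> i ip; split; last exact: skeleton_class_closed.
  (* the complement is the union of the finitely many other classes *)
  rewrite (_ : skeleton_class x p i = ~` \bigcup_(j in
      [set j : nat | (j < p)%N] `&` [set j | i <> j]) skeleton_class x p j).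
    rewrite openC; apply: closed_bigcup.
      exact/finite_setIl/finite_II.
    by move=> j _; exact: skeleton_class_closed.
  apply/seteqP; split=> [y yi [j [jp ij] yj]|y yN].
    by have : set0 y by rewrite -(disj _ _ ip jp ij).
  have [j jp yj] : (\bigcup_(j in [set j : nat | (j < p)%N])
      skeleton_class x p j) y by rewrite -skeleton_class_cover.
  have [<-//|/eqP ji] := eqVneq j i.
  by case: yN; exists j => //; split=> // /esym.
- by move=> [//|i] _; rewrite orbit_shift_skeleton_class.
- rewrite orbit_shift_skeleton_class prednK//.
  (* the classes of indices 0 and p coincide, as 0 and p agree modulo p *)
  by apply/seteqP; split=> y; apply: skeleton_shift_mod;
    rewrite ?sub0r ?subr0 ?rpredN.
- exact: skeleton_class_cover.
Qed.

End skeletons.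

Theorem lemma5 (R : realType) (Sigma : topologicalType)
    (Sigma_compact : compact [set: Sigma])
    (Sigma_hausdorff : hausdorff_space Sigma)
    (x : {ptws int -> Sigma})
    (x_nonperiodic : nonperiodic x)
    (x_recurrent : recurrent x)
    (x_limsup : limn_esup (fun p : nat => max_run R p x) = +oo%E)
    (p : nat -> nat)
    (p_increasing : forall i j : nat, (i < j)%N -> (p i < p j)%N)
    (p_essential : forall i : nat, essential_period x (p i))
    (p_dvd : forall i : nat, (p i %| p i.+1)%N)
    (p_lim : (fun i : nat => max_run R (p i) x) @ \oo --> +oo%E) :
  (forall i : nat,
     periodic_partition (orbit_shift x) (p i)
       (fun j : nat => skeleton_class x (p i) j)) /\
  (forall i j n m : nat, (i < j)%N -> (n < p i)%N -> (m < p j)%N ->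
     (m = n %[mod p i])%N ->
     skeleton_class x (p j) m `<=` skeleton_class x (p i) n).
Proof.
split=> [i|i j n m ij _ _ mn y].
  exact: skeleton_class_periodic_partition.
have pij : (p i %| p j)%N.
  elim: j ij => // j IH; rewrite ltnS leq_eqVlt => /orP[/eqP->|/IH pij].
    exact: p_dvd.
  exact: dvdn_trans pij (p_dvd j).
apply: skeleton_shift_mono => //.
by rewrite -eqz_mod_dvd !modz_nat mn.
Qed.
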